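(* Let $K$ be a field and let $V$ be a vector space over $K$. Let $CTD(V)$ be the free unital commutative tridendriform algebra (free unital CTD-algebra) on $V$, and let $T^q(\bar S(V))$ be the quasi-shuffle algebra over the reduced symmetric algebra $\bar S(V)$ (the polynomials without constant term), with its unital CTD-algebra structure given by the operations $\prec$ and $\cdot$. Then the morphism of unital CTD-algebras $\Phi: CTD(V)\to T^q(\bar S(V))$ which extends the inclusion $V\hookrightarrow \bar S(V)\hookrightarrow T^q(\bar S(V))$ is an isomorphism; that is, the free unital CTD-algebra on $V$ is isomorphic to $T^q(\bar S(V))$: $$\Phi: CTD(V)\cong T^q(\bar S(V)).$$
   Context: All vector spaces and tensor products are over $K$. CTD-algebras. A commutative tridendriform algebra (CTD-algebra) is a vector space $A$ with two bilinear operations $\prec$ and $\cdot$ such that for all $x,y,z\in A$: $x\cdot y=y\cdot x$; $(x\prec y)\prec z=x\prec(y\prec z+z\prec y+y\cdot z)$; $(x\cdot y)\prec z=x\cdot(y\prec z)$; $(x\cdot y)\cdot z=x\cdot(y\cdot z)$. One puts $x*y:=x\prec y+y\prec x+x\cdot y$. A unital CTD-algebra is a vector space $A=K1\oplus\bar A$ where $\bar A$ (the augmentation ideal) is a CTD-algebra, with the operations extended by $1\cdot x=0=x\cdot 1$, $1\prec x=0$, $x\prec 1=x$ for $x\in\bar A$; $1\prec 1$ and $1\cdot 1$ are not defined, and $1$ is the unit for $*$. Morphisms of unital CTD-algebras are linear maps sending $1$ to $1$, augmentation ideal to augmentation ideal, and compatible with $\prec$ and $\cdot$. Free CTD-algebra.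 The free unital CTD-algebra on $V$ is a unital CTD-algebra $CTD(V)$ with a linear map $V\to \overline{CTD(V)}$ such that any linear map $\phi:V\to\bar A$, with $A$ a unital CTD-algebra, extends uniquely to a morphism of unital CTD-algebras $CTD(V)\to A$. Symmetric algebra. $\bar S(V)=\bigoplus_{n\ge1}S^n(V)$, where $S^n(V)$ is the quotient of $V^{\otimes n}$ by the action of the symmetric group, is a nonunital commutative algebra under polynomial multiplication. Quasi-shuffle algebra. For a (not necessarily unital) commutative associative algebra $(R,\cdot)$, let $T(R)=K1\oplus R\oplus R^{\otimes2}\oplus\cdots$ and $\bar T(R)=R\oplus R^{\otimes 2}\oplus\cdots$; tensors are written as words by concatenation, so $ax$ denotes $a\otimes x$ for $a\in R$, $x\in T(R)$. The operations $\prec$, $\succ$, $\cdot$ are defined inductively, for $a,b\in R$ and $x,y\in T(R)$, by $ax\cdot by=(a\cdot b)(x*y)$, $ax\prec by=a(x*by)$, $ax\succ by=b(ax*y)$, where $x*y:=x\prec y+x\succ y+x\cdot y$, and where, for $x\in\bar T(R)$, $1\cdot x=x\cdot1=0$, $1\prec x=0$, $x\prec1=x$, $1\succ x=x$, $x\succ 1=0$, with $1$ the unit of $*$. $T^q(R)$ is $T(R)$ with these operations; since $R$ is commutative, $x\succ y=y\prec x$, and $T^q(R)$ with $\prec$ and $\cdot$ is a unital CTD-algebra. *)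

(* Defs.v *)
From HB Require Import structures.
From mathcomp Require Import all_boot ssralg ring_quotient.
From mathcomp Require Import boolp.
From mathcomp Require Import finmap monalg.

Set Implicit Arguments.
Unset Strict Implicit.
Unset Printing Implicit Defensive.

Import GRing.Theory.
Local Open Scope ring_scope.
Local Open Scope quotient_scope.

Section Quotient.
Variables (K : fieldType) (L : lmodType K) (G : L -> Prop).

Inductive span : L -> Prop :=
| span0 : span 0
| spanD a g x : G g -> span x -> span (a *: g + x).

Lemma span_add x y : span x -> span y -> span (x + y).
Proof.
elim=> [|a g z Gg _ IH] sy; first by rewrite add0r.
by rewrite -addrA; apply: spanD => //; apply: IH.
Qed.

Lemma span_scale k x : span x -> span (k *: x).
Proof.
elim=> [|a g z Gg _ IH]; first by rewrite scaler0; apply: span0.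
by rewrite scalerDr scalerA; apply: spanD.
Qed.

Lemma span_gen g : G g -> span g.
Proof. by move=> Gg; rewrite -[g]addr0 -[g]scale1r; apply: spanD => //; apply: span0. Qed.

Definition spanb : {pred L} := fun x => `[< span x >].

Lemma spanb_zmod_closed : zmod_closed spanb.
Proof.
split=> [|x y /asboolP sx /asboolP sy]; first by apply/asboolP/span0.
by apply/asboolP/span_add => //; rewrite -scaleN1r; apply: span_scale.
Qed.
HB.instance Definition _ := GRing.isZmodClosed.Build L spanb spanb_zmod_closed.

Definition lquot := @Quotient.quot L spanb.
HB.instance Definition _ := GRing.Zmodule.on lquot.

Definition lpi (x : L) : lquot := \pi_(@Quotient.quot L spanb) x.

Lemma lpi_eq x y : span (x - y) -> lpi x = lpi y.
Proof. by move=> s; apply/eqP; rewrite /lpi -Quotient.idealrBE; apply/asboolP. Qed.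

Lemma lpi_eqP x y : lpi x = lpi y -> span (x - y).
Proof. by move/eqP; rewrite /lpi -Quotient.idealrBE => /asboolP. Qed.

Lemma lpiD x y : lpi (x + y) = lpi x + lpi y.
Proof. exact: Quotient.pi_add. Qed.

Definition lrepr (x : lquot) : L := repr (x : @Quotient.quot L spanb).

Lemma lreprK x : lpi (lrepr x) = x.
Proof. exact: (@reprK L (@Quotient.quot L spanb)). Qed.

Definition lscale (k : K) (x : lquot) : lquot := lpi (k *: lrepr x).

Lemma lpiZ k x : lpi (k *: x) = lscale k (lpi x).
Proof.
apply: lpi_eq; rewrite -scalerBr; apply: span_scale.
by apply: lpi_eqP; rewrite lreprK.
Qed.

Lemma lscaleA a b x : lscale a (lscale b x) = lscale (a * b) x.
Proof. by rewrite -[x]lreprK -!lpiZ scalerA. Qed.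
Lemma lscale1 : left_id 1 lscale.
Proof. by move=> x; rewrite -[x]lreprK -!lpiZ scale1r. Qed.
Lemma lscaleDr : right_distributive lscale +%R.
Proof.
by move=> a x y; rewrite -[x]lreprK -[y]lreprK -lpiD -!lpiZ -lpiD scalerDr.
Qed.
Lemma lscaleDl x : {morph lscale^~ x : a b / a + b}.
Proof. by move=> a b; rewrite -[x]lreprK -!lpiZ -lpiD scalerDl. Qed.

HB.instance Definition _ := GRing.Zmodule_isLmodule.Build K lquot
  lscaleA lscale1 lscaleDr lscaleDl.

Lemma lpi_linear : linear lpi.
Proof. by move=> k x y; rewrite lpiD lpiZ. Qed.

HB.instance Definition _ := GRing.isLinear.Build K L lquot *:%R lpi lpi_linear.

Lemma lpiP k x y : lpi (k *: x + y) = k *: lpi x + lpi y.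
Proof. exact: lpi_linear. Qed.

Lemma lpi_gen g : G g -> lpi g = 0.
Proof.
by move=> Gg; rewrite -(raddf0 lpi); apply: lpi_eq; rewrite subr0; apply: span_gen.
Qed.

Section Lift.
Variables (M : lmodType K) (f : {linear L -> M}).
Hypothesis fG : forall g, G g -> f g = 0.

Lemma lift_lreprE x : f (lrepr (lpi x)) = f x.
Proof.
have: span (lrepr (lpi x) - x) by apply: lpi_eqP; rewrite lreprK.
move=> s; apply/eqP; rewrite -subr_eq0 -raddfB; apply/eqP.
elim: s => [|a g z Gg _ IH]; first by rewrite raddf0.
by rewrite /= linearP fG // scaler0 add0r; exact: IH.
Qed.

Lemma lift_linear : linear (fun x => f (lrepr x)).
Proof.
move=> k x y; rewrite -[x in LHS]lreprK -[y in LHS]lreprK -linearP.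
by rewrite lift_lreprE linearP.
Qed.
End Lift.
End Quotient.

Section LinearExtension.
Variables (K : fieldType) (W : choiceType) (M : lmodType K).

Definition linext (f : W -> M) (g : {malg K[W]}) : M :=
  \sum_(w <- msupp g) g@_w *: f w.

Lemma linextEw f g (D : {fset W}) : (msupp g `<=` D)%fset ->
  linext f g = \sum_(w <- D) g@_w *: f w.
Proof.
move=> sD; rewrite /linext (big_fset_incl _ sD) // => w _ /mcoeff_outdom ->.
by rewrite scale0r.
Qed.

Lemma linext_is_linear f : linear (linext f).
Proof.
move=> k g h.
pose D := (msupp g `|` msupp h)%fset.
have sg : (msupp g `<=` D)%fset by apply: fsubsetUl.
have sh : (msupp h `<=` D)%fset by apply: fsubsetUr.
rewrite (linextEw f sg) (linextEw f sh) (@linextEw f _ D); last first.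
  apply: fsubset_trans (msuppD_le _ _) _; rewrite fsubUset sh andbT.
  exact: fsubset_trans (msuppZ_le _ _) sg.
rewrite scaler_sumr -big_split /=; apply: eq_bigr => w _.
by rewrite mcoeffD mcoeffZ scalerDl scalerA.
Qed.
HB.instance Definition _ f :=
  GRing.isLinear.Build K {malg K[W]} M *:%R (linext f) (linext_is_linear f).

Lemma linextU f w : linext f << w >> = f w.
Proof.
by rewrite /linext msuppU oner_eq0 big_seq_fset1 mcoeffUU scale1r.
Qed.
End LinearExtension.

Section TensorModule.
Variables (K : fieldType) (R : lmodType K).

(* A nonempty word is given by its first letter and the remaining ones. *)
Definition nword := (R * seq R)%type.
HB.instance Definition _ := Choice.on nword.

Definition nw (u : seq R) (a : R) (v : seq R) : nword :=
  if u is c :: u' then (c, u' ++ a :: v) else (a, v).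

Inductive multilin_rel : {malg K[nword]} -> Prop :=
  Multilin u k a b v : multilin_rel
    (<< nw u (k *: a + b) v >> - (k *: << nw u a v >> + << nw u b v >>)).

Definition Tbar : lmodType K := lquot multilin_rel.

Definition multilin (M : lmodType K) (f : nword -> M) :=
  forall u v, linear (fun a => f (nw u a v)).

End TensorModule.

(* The pure tensor $a_0 \otimes a_1 \otimes \cdots \otimes a_n$. *)
HB.lock Definition tensor (K : fieldType) (R : lmodType K) (w : nword R) :
  Tbar R := lpi (@multilin_rel K R) << w >>.

Lemma tensor_multilin (K : fieldType) (R : lmodType K) : multilin (@tensor K R).
Proof.
move=> u v k a b; apply/eqP; rewrite unlock -lpi_linear -subr_eq0 -raddfB.
by apply/eqP/lpi_gen.
Qed.

HB.lock Definition tlift (K : fieldType) (R M : lmodType K)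
  (f : nword R -> M) (t : Tbar R) : M := linext f (lrepr t).

Section TLift.
Variables (K : fieldType) (R M : lmodType K) (f : nword R -> M).
Hypothesis fm : multilin f.

Lemma tlift_rel g : multilin_rel g -> linext f g = 0.
Proof. by case=> u k a b v; rewrite raddfB /= linearP /= !linextU fm subrr. Qed.

Lemma tlift_linear : linear (tlift f).
Proof. rewrite unlock; exact: (lift_linear (f := linext f) tlift_rel). Qed.

Lemma tliftE w : tlift f (tensor w) = f w.
Proof.
rewrite !unlock (lift_lreprE (f := linext f) tlift_rel).
exact: linextU.
Qed.
End TLift.

Section TbarInd.
Variables (K : fieldType) (R : lmodType K).

Lemma Tbar_ind (P : Tbar R -> Prop) : P 0 ->
  (forall k w t, P t -> P (k *: tensor w + t)) -> forall t, P t.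
Proof.
move=> P0 PD t; rewrite -[t](lreprK t) [lrepr t]monalgE raddf_sum /=.
elim: (X in \sum_(_ <- X) _) => [|w s IH]; first by rewrite big_nil.
rewrite big_cons.
suff -> : lpi (@multilin_rel K R) << (lrepr t)@_w *g w >> = (lrepr t)@_w *: tensor w.
  exact: PD.
rewrite unlock -linearZ /=; congr lpi; apply/malgP => w'.
by rewrite mcoeffZ !mcoeffU mulrnAr mulr1.
Qed.

Lemma Tbar_eq (M : lmodType K) (f g : Tbar R -> M) : linear f -> linear g ->
  (forall w, f (tensor w) = g (tensor w)) -> f =1 g.
Proof.
move=> lf lg e; have f0 (h : Tbar R -> M) : linear h -> h 0 = 0.
  by move=> lh; have := lh (-1) 0 0; rewrite scaler0 addr0 scaleN1r addNr.
apply: Tbar_ind => [|k w t IH]; first by rewrite !f0.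
by rewrite lf lg e IH.
Qed.
End TbarInd.

Definition bilin (K : fieldType) (L M N : lmodType K) (f : L -> M -> N) :=
  (forall y, linear (f^~ y)) /\ (forall x, linear (f x)).

HB.lock Definition tlift2 (K : fieldType) (R S M : lmodType K)
  (f : nword R -> nword S -> M) (x : Tbar R) (y : Tbar S) : M :=
  tlift (fun w => tlift (f w) y) x.

Section TLift2.
Variables (K : fieldType) (R S M : lmodType K) (f : nword R -> nword S -> M).
Hypotheses (fl : forall w', multilin (f^~ w')) (fr : forall w, multilin (f w)).

Lemma tlift2_multilin y : multilin (fun w => tlift (f w) y).
Proof.
move=> u v k a b.
elim/Tbar_ind: y => [|c w t IH].
  have z w : tlift (f w) 0 = 0.
    have := tlift_linear (fr w) (-1) 0 0.
    by rewrite scaler0 addr0 scaleN1r addNr.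
  by rewrite !z scaler0 addr0.
rewrite !(tlift_linear (fr _)) !(tliftE (fr _)) IH (fl w) !scalerDr !scalerA.
by rewrite (mulrC c) addrACA.
Qed.

Lemma tlift2_bilin : bilin (tlift2 f).
Proof.
rewrite unlock.
split=> [y|x]; first exact: tlift_linear (tlift2_multilin y).
move=> k y z; elim/Tbar_ind: x => [|c w t IH].
  have z0 y' : tlift (fun w => tlift (f w) y') 0 = 0.
    have := tlift_linear (tlift2_multilin y') (-1) 0 0.
    by rewrite scaler0 addr0 scaleN1r addNr.
  by rewrite !z0 scaler0 addr0.
have e y' : tlift (fun w => tlift (f w) y') (c *: tensor w + t) =
    c *: tlift (f w) y' + tlift (fun w => tlift (f w) y') t.
  rewrite (tlift_linear (tlift2_multilin y')).
  by rewrite (tliftE (tlift2_multilin y')).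
rewrite !e IH (tlift_linear (fr w)) !scalerDr !scalerA.
by rewrite (mulrC c) addrACA.
Qed.

Lemma tlift2E w w' : tlift2 f (tensor w) (tensor w') = f w w'.
Proof. by rewrite [tlift2]unlock (tliftE (tlift2_multilin _)) tliftE. Qed.
End TLift2.

Lemma linear_at0 (K : fieldType) (L M : lmodType K) (f : L -> M) :
  linear f -> f 0 = 0.
Proof. by move=> lf; have := lf (-1) 0 0; rewrite scaler0 addr0 scaleN1r addNr. Qed.

Lemma lcomb1 (K : fieldType) (M : lmodType K) (k c : K) (p q r s : M) :
  c *: (k *: p + q) + (k *: r + s) = k *: (c *: p + r) + (c *: q + s).
Proof. by rewrite !scalerDr !scalerA (mulrC c) addrACA. Qed.

Lemma lcomb2 (K : fieldType) (M : lmodType K) (k : K) (x y z x' y' z' : M) :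
  k *: x + x' + (k *: y + y') + (k *: z + z')
  = k *: (x + y + z) + (x' + y' + z').
Proof. by rewrite !scalerDr [LHS](AC (2*2*2) (1*3*5*(2*4*6))). Qed.

Lemma lcomb3 (K : fieldType) (M : lmodType K) (c d e k : K) (x y z p q : M) :
  k *: p + q + (c *: (k *: y + z) + (k * d + e) *: x)
  = k *: (p + (c *: y + d *: x)) + (q + (c *: z + e *: x)).
Proof.
rewrite !scalerDr !scalerA scalerDl (mulrC c).
by rewrite [LHS](AC (2*(2*2)) (1*(3*5)*(2*(4*6)))).
Qed.

HB.mixin Record isNonUnitalComAlg (K : fieldType) R of GRing.Lmodule K R := {
  nmul : R -> R -> R;
  nmul_bilin : bilin nmul;
  nmulC : commutative nmul;
  nmulA : associative nmul
}.

#[short(type="nonUnitalComAlgType")]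
HB.structure Definition NonUnitalComAlg (K : fieldType) :=
  {R of GRing.Lmodule K R & isNonUnitalComAlg K R}.

Section SymmetricAlgebra.
Variables (K : fieldType) (V : lmodType K).

Definition tcat (x y : Tbar V) : Tbar V :=
  tlift2 (fun w w' => tensor (w.1, w.2 ++ w'.1 :: w'.2)) x y.

(* The differences $t - \sigma \cdot t$ for a pure tensor $t$ and a
   permutation $\sigma$ of its factors. *)
Inductive sym_rel : Tbar V -> Prop :=
  Sym w w' of perm_eq (w.1 :: w.2) (w'.1 :: w'.2) :
    sym_rel (tensor w - tensor w').

Definition Sbar_lmod : lmodType K := lquot sym_rel.

(* The product of polynomials is induced by the concatenation of words. *)
Definition smul (x y : Sbar_lmod) : Sbar_lmod :=
  lpi sym_rel (tcat (lrepr x) (lrepr y)).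

Lemma tcatl w : multilin (fun w' : nword V => tensor (w.1, w.2 ++ w'.1 :: w'.2)).
Proof.
case: w => c s [|d u] v k a b /=; first exact: (tensor_multilin (c :: s)).
by have := tensor_multilin (c :: s ++ d :: u) v k a b; rewrite /= -!catA.
Qed.

Lemma tcatr w' : multilin (fun w : nword V => tensor (w.1, w.2 ++ w'.1 :: w'.2)).
Proof.
case: w' => c s [|d u] v k a b /=; first exact: (tensor_multilin [::]).
by have := tensor_multilin (d :: u) (v ++ c :: s) k a b; rewrite /= -!catA.
Qed.

Lemma tcatE w w' :
  tcat (tensor w) (tensor w') = tensor (w.1, w.2 ++ w'.1 :: w'.2).
Proof. exact: (tlift2E tcatr tcatl). Qed.

Lemma tcat_bilin : bilin tcat.
Proof. exact: (tlift2_bilin tcatr tcatl). Qed.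

Lemma lpi_sym w w' : perm_eq (w.1 :: w.2) (w'.1 :: w'.2) ->
  lpi sym_rel (tensor w) = lpi sym_rel (tensor w').
Proof. by move=> p; apply: lpi_eq; apply: span_gen; apply: Sym. Qed.

Lemma pi_tcatC x y : lpi sym_rel (tcat x y) = lpi sym_rel (tcat y x).
Proof.
have [bl br] := tcat_bilin.
elim/Tbar_ind: x => [|k w t IH]; first by rewrite (linear_at0 (bl y)) (linear_at0 (br y)).
rewrite bl br 2!lpiP IH; congr (_ *: _ + _).
elim/Tbar_ind: y {IH} => [|c w' z IH].
  by rewrite (linear_at0 (bl _)) (linear_at0 (br _)).
rewrite bl br 2!lpiP IH; congr (_ *: _ + _).
by rewrite !tcatE; apply: lpi_sym; rewrite -!cat_cons perm_catC.
Qed.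

Lemma pi_tcat0 x y : lpi sym_rel x = 0 -> lpi sym_rel (tcat x y) = 0.
Proof.
have [bl br] := tcat_bilin.
rewrite -(raddf0 (lpi sym_rel)) => /lpi_eqP; rewrite subr0.
elim=> [|k g z [w w' p] _ IH]; first by rewrite (linear_at0 (bl y)).
rewrite bl lpiP IH raddf0 addr0.
suff -> : lpi sym_rel (tcat (tensor w - tensor w') y) = 0 by rewrite scaler0.
have bB a b : tcat (a - b) y = tcat a y - tcat b y.
  by rewrite addrC -scaleN1r bl scaleN1r addrC.
rewrite bB raddfB /=; apply/eqP; rewrite subr_eq0; apply/eqP.
elim/Tbar_ind: y {bB IH} => [|c w1 t IH]; first by rewrite !(linear_at0 (br _)).
rewrite !br 2!lpiP IH !tcatE; congr (_ *: _ + _).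
by apply: lpi_sym; rewrite -!cat_cons perm_cat2r.
Qed.

Lemma pi_tcatl x x' y : lpi sym_rel x = lpi sym_rel x' ->
  lpi sym_rel (tcat x y) = lpi sym_rel (tcat x' y).
Proof.
have [bl br] := tcat_bilin => e; apply/eqP; rewrite -subr_eq0 -raddfB; apply/eqP.
have bB a b z : tcat (a - b) z = tcat a z - tcat b z.
  by rewrite addrC -scaleN1r bl scaleN1r addrC.
by rewrite -bB /= pi_tcat0 // raddfB /= e subrr.
Qed.

Lemma smulC : commutative smul.
Proof. by move=> x y; rewrite /smul pi_tcatC. Qed.

Lemma smul_pi x y :
  smul (lpi sym_rel x) (lpi sym_rel y) = lpi sym_rel (tcat x y).
Proof.
apply: (etrans (pi_tcatl _ (lreprK (lpi sym_rel x)))).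
apply: (etrans (pi_tcatC _ _)).
apply: (etrans (pi_tcatl _ (lreprK (lpi sym_rel y)))).
exact: pi_tcatC.
Qed.

Lemma smul_bilin : bilin smul.
Proof.
have [bl br] := tcat_bilin.
suff bl' y : linear (smul^~ y).
  by split=> // x k y z; rewrite ![smul x _]smulC bl'.
move=> k x z; rewrite -[x]lreprK -[z]lreprK -[y]lreprK -lpi_linear !smul_pi.
by rewrite bl lpi_linear.
Qed.

Lemma tcatA x y z : tcat x (tcat y z) = tcat (tcat x y) z.
Proof.
have [bl br] := tcat_bilin.
elim/Tbar_ind: x => [|k w x IH]; first by rewrite !(linear_at0 (bl _)).
rewrite !bl {}IH; congr (_ *: _ + _).
elim/Tbar_ind: y => [|c w1 y IH].
  by rewrite (linear_at0 (bl z)) (linear_at0 (br _)) (linear_at0 (bl z)).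
rewrite !(bl, br) {}IH; congr (_ *: _ + _).
elim/Tbar_ind: z => [|d w2 z IH]; first by rewrite !(linear_at0 (br _)).
by rewrite !br {}IH !tcatE /= -catA.
Qed.

Lemma smulA : associative smul.
Proof.
move=> x y z; rewrite -[x]lreprK -[y]lreprK -[z]lreprK !smul_pi.
by rewrite tcatA.
Qed.

Definition Sbar : nonUnitalComAlgType K :=
  HB.pack (GRing.Lmodule.sort Sbar_lmod)
    (isNonUnitalComAlg.Build K Sbar_lmod smul_bilin smulC smulA).

(* The inclusion of $V = S^1(V)$. *)
Definition svar (v : V) : Sbar := lpi sym_rel (tensor (v, [::])).

End SymmetricAlgebra.

HB.mixin Record isCTD (K : fieldType) A of GRing.Lmodule K A := {
  prec : A -> A -> A;
  dot : A -> A -> A;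
  prec_bilin : bilin prec;
  dot_bilin : bilin dot;
  dotC : forall x y, dot x y = dot y x;
  precA : forall x y z,
    prec (prec x y) z = prec x (prec y z + prec z y + dot y z);
  dot_prec : forall x y z, prec (dot x y) z = dot x (prec y z);
  dotA : forall x y z, dot (dot x y) z = dot x (dot y z)
}.

#[short(type="ctdType")]
HB.structure Definition CTD (K : fieldType) :=
  {A of GRing.Lmodule K A & isCTD K A}.

(* [unital A] is the vector space $K1 \oplus A$; the unital CTD-algebras are
   the spaces [unital A] with [A] a CTD-algebra, the augmentation ideal. *)
Definition unital (K : fieldType) (A : lmodType K) : lmodType K :=
  (K^o * A)%type.

Section StarOf.
Variables (K : fieldType) (A : lmodType K) (p d : A -> A -> A).

Definition star_of (x y : unital A) : unital A :=
  (x.1 * y.1, p x.2 y.2 + p y.2 x.2 + d x.2 y.2 + (x.1 *: y.2 + y.1 *: x.2)).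

Hypotheses (dC : forall x y, d x y = d y x) (pb : bilin p) (db : bilin d).

Lemma star_ofC x y : star_of x y = star_of y x.
Proof.
rewrite /star_of (mulrC x.1) (dC x.2) (addrC (p x.2 y.2)).
by rewrite (addrC (x.1 *: y.2)).
Qed.

Lemma star_of_bilin : bilin star_of.
Proof.
suff r x : linear (star_of x).
  by split=> // y k x z; rewrite ![star_of _ y]star_ofC r.
have [pl pr] := pb; have [dl dr] := db.
move=> k y z; apply: injective_projections => /=.
  by rewrite mulrDr mulrCA.
by rewrite pl pr dr lcomb2 lcomb3.
Qed.

Lemma star_of_inj x y :
  star_of (0, x) (0, y) = (0, p x y + p y x + d x y) :> unital A.
Proof. by rewrite /star_of /= mulr0 !scale0r !addr0. Qed.

Lemma star_of1x x : star_of (1, 0) x = x.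
Proof.
case: x => k x; rewrite /star_of /= mul1r scale1r scaler0 addr0.
by rewrite (linear_at0 (pb.1 x)) (linear_at0 (pb.2 x)) (linear_at0 (db.1 x)) !add0r.
Qed.

Lemma star_ofx1 x : star_of x (1, 0) = x.
Proof. by rewrite star_ofC star_of1x. Qed.
End StarOf.

Section Unital.
Variables (K : fieldType) (A : ctdType K).
Implicit Types u v : unital A.

Definition uone : unital A := (1, 0).
Definition uinj (x : A) : unital A := (0, x).
Definition in_aug u : Prop := u.1 = 0.

(* $\prec$ and $\cdot$ are defined on $A\otimes\bar A + \bar A\otimes A$ only;
   the value at a pair for which [udef] fails is junk. *)
Definition udef u v : Prop := in_aug u \/ in_aug v.
Definition uprec u v : unital A := uinj (prec u.2 v.2 + v.1 *: u.2).
Definition udot u v : unital A := uinj (dot u.2 v.2).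
Definition ustar u v : unital A := star_of (@prec K A) (@dot K A) u v.

Lemma uprec1x x : uprec uone (uinj x) = 0.
Proof.
by rewrite /uprec /= (linear_at0 (prec_bilin.1 x)) scaler0 addr0.
Qed.

Lemma uprecx1 x : uprec (uinj x) uone = uinj x.
Proof.
by rewrite /uprec /= (linear_at0 (prec_bilin.2 x)) scale1r add0r.
Qed.

Lemma udot1x x : udot uone (uinj x) = 0.
Proof. by rewrite /udot /= (linear_at0 (dot_bilin.1 x)). Qed.

Lemma udotx1 x : udot (uinj x) uone = 0.
Proof. by rewrite /udot /= (linear_at0 (dot_bilin.2 x)). Qed.

Lemma uprec_inj x y : uprec (uinj x) (uinj y) = uinj (prec x y).
Proof. by rewrite /uprec /= scale0r addr0. Qed.

Lemma udot_inj x y : udot (uinj x) (uinj y) = uinj (dot x y).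
Proof. by []. Qed.

Lemma ustar1u u : ustar uone u = u.
Proof. exact: (star_of1x prec_bilin dot_bilin). Qed.

Lemma ustaru1 u : ustar u uone = u.
Proof. exact: (star_ofx1 dotC prec_bilin dot_bilin). Qed.

Lemma ustar_inj x y :
  ustar (uinj x) (uinj y) = uinj (prec x y + prec y x + dot x y).
Proof. exact: star_of_inj. Qed.
End Unital.

Section Morphisms.
Variables (K : fieldType).

Record uctd_morphism (A B : ctdType K) (f : unital A -> unital B) : Prop := {
  uctd_linear : linear f;
  uctd_one : f (uone A) = uone B;
  uctd_aug : forall u, in_aug u -> in_aug (f u);
  uctd_prec : forall u v, udef u v -> f (uprec u v) = uprec (f u) (f v);
  uctd_dot : forall u v, udef u v -> f (udot u v) = udot (f u) (f v)
}.

Definition uctd_isomorphism (A B : ctdType K) (f : unital A -> unital B) :=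
  uctd_morphism f /\
  exists g : unital B -> unital A,
    [/\ uctd_morphism g, cancel f g & cancel g f].

Definition free_uctd (V : lmodType K) (F : ctdType K) (i : {linear V -> F}) :=
  forall (A : ctdType K) (phi : {linear V -> A}),
    exists f : unital F -> unital A,
      [/\ uctd_morphism f,
          forall v, f (uinj (i v)) = uinj (phi v) &
          forall g : unital F -> unital A, uctd_morphism g ->
            (forall v, g (uinj (i v)) = uinj (phi v)) -> g =1 f].
End Morphisms.

Section AssocStep.
Variables (K : fieldType) (R B T : lmodType K) (inj : B -> T).
Variables (cons : R -> T -> B) (st : T -> T -> T) (mul : R -> R -> R).
Hypotheses (inj_lin : linear inj) (cons_lin : forall a, linear (cons a)).
Hypotheses (st_bilin : bilin st) (mulA : associative mul).
Hypothesis st_cons : forall a x b y, st (inj (cons a x)) (inj (cons b y)) =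
  inj (cons a (st x (inj (cons b y))) + cons b (st (inj (cons a x)) y)
       + cons (mul a b) (st x y)).

Let lin_add (L M : lmodType K) (f : L -> M) : linear f ->
  forall x y, f (x + y) = f x + f y.
Proof. by move=> lf x y; have := lf 1 x y; rewrite !scale1r. Qed.

Let add9 (M : lmodType K) (x1 z1 y1 x2 z2 y2 x3 z3 y3 : M) :
  x1 + z1 + y1 + (x2 + z2 + y2) + (x3 + z3 + y3) =
  x1 + x2 + x3 + (z1 + z2 + z3) + y1 + y2 + y3.
Proof. by rewrite [LHS](AC (3*3*3) (1*4*7*(2*5*8)*3*6*9)). Qed.

Lemma assoc_step a b c X Y Z (ax := inj (cons a X)) (b_y := inj (cons b Y))
    (cz := inj (cons c Z)) :
  st (st X b_y) cz = st X (st b_y cz) -> st (st ax Y) cz = st ax (st Y cz) ->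
  st (st X Y) cz = st X (st Y cz) -> st (st ax b_y) Z = st ax (st b_y Z) ->
  st (st X b_y) Z = st X (st b_y Z) -> st (st ax Y) Z = st ax (st Y Z) ->
  st (st X Y) Z = st X (st Y Z) -> st (st ax b_y) cz = st ax (st b_y cz).
Proof.
have [sl sr] := st_bilin.
have injD := lin_add inj_lin.
have slD t := lin_add (sl t).
have srD t := lin_add (sr t).
have crD e := lin_add (cons_lin e).
rewrite {2}/b_y {2}/cz st_cons -/b_y -/cz => E1 E2 E3 E4 E5 E6 E7.
rewrite !injD !srD in E1.
have Eab : st ax b_y = _ := st_cons a X b Y.
have Ec d W : st (inj (cons d W)) cz = _ := st_cons d W c Z.
have Ea d W : st ax (inj (cons d W)) = _ := st_cons a X d W.
rewrite Eab !injD !slD -/ax -/b_y in E4.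
rewrite Eab !injD !slD !srD -/ax -/b_y !Ec !Ea -!injD -/ax -/cz; congr (inj _).
rewrite add9 -!crD E4 E1 !crD E2 E3 E5 E6 E7 mulA.
by rewrite [LHS](ACl (1*4*5*(2*6*7)*(3*8*9))).
Qed.
End AssocStep.

Section QuasiShuffle.
Variables (K : fieldType) (R : nonUnitalComAlgType K).
Implicit Types (a b c : R) (s u v : seq R) (w : nword R).

Let T : lmodType K := unital (Tbar R).

(* $a_1\cdots a_n$ in $T(R) = K1 \oplus \bar T(R)$; the empty word is $1$. *)
Definition tword s : T := if s is a :: s' then (0, tensor (a, s')) else (1, 0).

(* $x \mapsto ax$. *)
Definition tcons a (x : T) : Tbar R :=
  x.1 *: tensor (a, [::]) + tlift (fun w => tensor (a, w.1 :: w.2)) x.2.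

(* The product $*$ of two words, with the formulas for the three operations
   substituted:
   $ax * by = ax\prec by + ax\succ by + ax\cdot by
   = a(x * by) + b(ax * y) + (a\cdot b)(x * y)$. *)
Fixpoint qstar u : seq R -> T :=
  if u is a :: x then
    fix qstar_u v : T :=
      if v is b :: y then
        (0, tcons a (qstar x (b :: y)) + tcons b (qstar_u y)
            + tcons (nmul a b) (qstar x y))
      else tword (a :: x)
  else tword.

Arguments qstar : simpl never.

Definition tprec : Tbar R -> Tbar R -> Tbar R :=
  tlift2 (fun w w' => tcons w.1 (qstar w.2 (w'.1 :: w'.2))).
Definition tdot : Tbar R -> Tbar R -> Tbar R :=
  tlift2 (fun w w' => tcons (nmul w.1 w'.1) (qstar w.2 w'.2)).

Let inj (t : Tbar R) : T := (0, t).

Lemma inj_linear : linear inj.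
Proof. by move=> k x y; apply: injective_projections; rewrite /= ?scaler0 ?addr0. Qed.

Lemma tcons_rel a : multilin (fun w => tensor (a, w.1 :: w.2)).
Proof.
move=> [|c s] v k x y /=; first exact: (tensor_multilin [:: a]).
exact: (tensor_multilin (a :: c :: s)).
Qed.

Lemma tcons_bilin : bilin tcons.
Proof.
split=> [x k a b|a k x y]; last first.
  rewrite /tcons /= (tlift_linear (tcons_rel a)) scalerDl scalerDr -scalerA.
  exact: addrACA.
rewrite /tcons (tensor_multilin [::] [::]).
suff -> : forall t, tlift (fun w => tensor (k *: a + b, w.1 :: w.2)) t =
  k *: tlift (fun w => tensor (a, w.1 :: w.2)) t +
       tlift (fun w => tensor (b, w.1 :: w.2)) t.
  exact: lcomb1.
have l c := tlift_linear (tcons_rel c).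
apply: Tbar_eq => [|i s t|[c s]]; first exact: l.
  by rewrite (l a) (l b); exact: lcomb1.
by rewrite !(tliftE (tcons_rel _)) (tensor_multilin [::]).
Qed.

Lemma tconsE a s : tcons a (tword s) = tensor (a, s).
Proof.
rewrite /tcons; case: s => [|b s] /=.
  by rewrite (linear_at0 (tlift_linear (tcons_rel a))) scale1r addr0.
by rewrite (tliftE (tcons_rel a)) scale0r add0r.
Qed.

Lemma twordS a s : tword (a :: s) = inj (tcons a (tword s)).
Proof. by rewrite tconsE. Qed.

Let smultilin (M : lmodType K) (f : seq R -> M) :=
  forall u v, linear (fun a => f (u ++ a :: v)).

Lemma nwE u a v : (nw u a v).1 :: (nw u a v).2 = u ++ a :: v.
Proof. by case: u. Qed.

Lemma tword_multilin : smultilin tword.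
Proof.
move=> u v k a b; case: u => [|c u] /=; rewrite -!/(inj _) -inj_linear.
  by rewrite (tensor_multilin [::]).
by rewrite (tensor_multilin (c :: u)).
Qed.

Arguments tword : simpl never.

Lemma qstarE a u b v : qstar (a :: u) (b :: v) =
  inj (tcons a (qstar u (b :: v)) + tcons b (qstar (a :: u) v)
       + tcons (nmul a b) (qstar u v)).
Proof. by []. Qed.

Lemma qstar0s v : qstar [::] v = tword v.
Proof. by []. Qed.

Lemma qstars0 u : qstar u [::] = tword u.
Proof. by case: u => [|a u]. Qed.

Lemma qstarC u v : qstar u v = qstar v u.
Proof.
elim: u v => [|a u IH] v; first by rewrite qstars0.
elim: v => [|b v IHv] //; rewrite !qstarE IHv !IH nmulC.
by congr (inj (_ + _)); rewrite addrC.
Qed.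

Lemma qstar_multilinl v : smultilin (qstar^~ v).
Proof.
have [cl cr] := tcons_bilin.
have [nl nr] := @nmul_bilin K R.
elim: v => [|c v IHv] u s k a b.
  by rewrite !qstars0 (tword_multilin u).
elim: u s k a b => [|d u IHu] s k a b.
  have {}IHv := IHv [::] s k a b; move: IHv => /= IHv.
  by rewrite /= !qstarE IHv nl !(cl, cr) lcomb2 inj_linear.
have IHv' := IHv (d :: u) s k a b; have IHw := IHv u s k a b.
move: IHv' IHw => /= IHv' IHw.
by rewrite /= !qstarE (IHu s k a b) IHv' IHw !cr lcomb2 inj_linear.
Qed.

Lemma qstar_multilinr u : smultilin (qstar u).
Proof. by move=> s v k a b; rewrite !(qstarC u) qstar_multilinl. Qed.

Lemma qprec_l w' :
  multilin (fun w => tcons w.1 (qstar w.2 (w'.1 :: w'.2))).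
Proof.
have [cl cr] := tcons_bilin.
by move=> [|c u] v k a b /=; rewrite ?cl // (qstar_multilinl _ u) cr.
Qed.

Lemma qprec_r w :
  multilin (fun w' => tcons w.1 (qstar w.2 (w'.1 :: w'.2))).
Proof.
have [cl cr] := tcons_bilin.
by move=> u v k a b; rewrite !nwE (qstar_multilinr _ u) cr.
Qed.

Lemma qdot_l w' :
  multilin (fun w => tcons (nmul w.1 w'.1) (qstar w.2 w'.2)).
Proof.
have [cl cr] := tcons_bilin; have [nl nr] := @nmul_bilin K R.
by move=> [|c u] v k a b /=; rewrite ?nl ?cl // (qstar_multilinl _ u) cr.
Qed.

Lemma qdot_r w :
  multilin (fun w' => tcons (nmul w.1 w'.1) (qstar w.2 w'.2)).
Proof.
have [cl cr] := tcons_bilin; have [nl nr] := @nmul_bilin K R.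
by move=> [|c u] v k a b /=; rewrite ?nr ?cl // (qstar_multilinr _ u) cr.
Qed.

Lemma tprec_bilin : bilin tprec.
Proof. exact: (tlift2_bilin qprec_l qprec_r). Qed.

Lemma tdot_bilin : bilin tdot.
Proof. exact: (tlift2_bilin qdot_l qdot_r). Qed.

Lemma tprecE w w' : tprec (tensor w) (tensor w') =
  tcons w.1 (qstar w.2 (w'.1 :: w'.2)).
Proof. exact: (tlift2E qprec_l qprec_r). Qed.

Lemma tdotE w w' : tdot (tensor w) (tensor w') =
  tcons (nmul w.1 w'.1) (qstar w.2 w'.2).
Proof. exact: (tlift2E qdot_l qdot_r). Qed.

Let tstar : T -> T -> T := star_of tprec tdot.

Lemma tdotC x y : tdot x y = tdot y x.
Proof.
have [dl dr] := tdot_bilin.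
suff H : tdot^~ y =1 tdot y by exact: (H x).
apply: Tbar_eq => [||w]; [exact: dl|exact: dr|].
suff H : tdot (tensor w) =1 tdot^~ (tensor w) by exact: (H y).
apply: Tbar_eq => [||w']; [exact: dr|exact: dl|].
rewrite (tdotE w) (tdotE w').
by rewrite nmulC qstarC.
Qed.

Lemma tstar_bilin : bilin tstar.
Proof. exact: (star_of_bilin tdotC tprec_bilin tdot_bilin). Qed.

Lemma tstarC x y : tstar x y = tstar y x.
Proof. exact: (star_ofC tprec tdotC). Qed.

Lemma tstarE u v : tstar (tword u) (tword v) = qstar u v.
Proof.
case: u => [|a u]; first exact: (star_of1x tprec_bilin tdot_bilin).
case: v => [|b v]; first exact: (star_ofx1 tdotC tprec_bilin tdot_bilin).
rewrite /tstar star_of_inj (tprecE (a, u)) (tprecE (b, v)) (tdotE (a, u)).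
by rewrite /= (qstarC v) qstarE.
Qed.

Lemma T_eq (M : lmodType K) (f g : T -> M) : linear f -> linear g ->
  (forall s, f (tword s) = g (tword s)) -> f =1 g.
Proof.
move=> lf lg e [k t].
have -> : (k, t) = k *: ((1, 0) : T) + inj t.
  apply: injective_projections => /=; last by rewrite scaler0 add0r.
  by rewrite addr0; exact: (esym (mulr1 k)).
rewrite lf lg (e [::]); congr (_ + _).
apply: (Tbar_eq (f := fun t => f (inj t)) (g := fun t => g (inj t))) => [||[a s]].
- by move=> c x y; rewrite inj_linear lf.
- by move=> c x y; rewrite inj_linear lg.
- exact: (e (a :: s)).
Qed.

Lemma lin_comp (L M N : lmodType K) (f : L -> M) (g : M -> N) :
  linear f -> linear g -> linear (fun x => g (f x)).
Proof. by move=> lf lg k x y; rewrite lf lg. Qed.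

Lemma tprec_cons a x b y :
  tprec (tcons a x) (tcons b y) = tcons a (tstar x (inj (tcons b y))).
Proof.
have [cl cr] := tcons_bilin; have [pl pr] := tprec_bilin.
have [sl sr] := tstar_bilin.
suff H : (fun x => tprec (tcons a x) (tcons b y))
     =1 (fun x => tcons a (tstar x (inj (tcons b y)))) by exact: (H x).
apply: T_eq => [||s].
- exact: (lin_comp (cr a) (pl _)).
- exact: (lin_comp (sl _) (cr a)).
suff H : (fun y => tprec (tcons a (tword s)) (tcons b y))
     =1 (fun y => tcons a (tstar (tword s) (inj (tcons b y)))) by exact: (H y).
apply: T_eq => [||s'].
- exact: (lin_comp (cr b) (pr _)).
- exact: (lin_comp (lin_comp (lin_comp (cr b) inj_linear) (sr _)) (cr a)).
by rewrite -twordS tstarE !tconsE tprecE.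
Qed.

Lemma tdot_cons a x b y :
  tdot (tcons a x) (tcons b y) = tcons (nmul a b) (tstar x y).
Proof.
have [cl cr] := tcons_bilin; have [dl dr] := tdot_bilin.
have [sl sr] := tstar_bilin.
suff H : (fun x => tdot (tcons a x) (tcons b y))
     =1 (fun x => tcons (nmul a b) (tstar x y)) by exact: (H x).
apply: T_eq => [||s].
- exact: (lin_comp (cr a) (dl _)).
- exact: (lin_comp (sl _) (cr _)).
suff H : (fun y => tdot (tcons a (tword s)) (tcons b y))
     =1 (fun y => tcons (nmul a b) (tstar (tword s) y)) by exact: (H y).
apply: T_eq => [||s'].
- exact: (lin_comp (cr b) (dr _)).
- exact: (lin_comp (sr _) (cr _)).
by rewrite tstarE !tconsE tdotE.
Qed.

Lemma tstar_cons a x b y :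
  tstar (inj (tcons a x)) (inj (tcons b y)) =
  inj (tcons a (tstar x (inj (tcons b y))) + tcons b (tstar (inj (tcons a x)) y)
       + tcons (nmul a b) (tstar x y)).
Proof.
rewrite {1}/tstar star_of_inj !tprec_cons tdot_cons.
by rewrite (tstarC y).
Qed.

Lemma tstarA_word x y z :
  tstar (tstar (tword x) (tword y)) (tword z) =
  tstar (tword x) (tstar (tword y) (tword z)).
Proof.
have [n] := ubnP (size x + size y + size z).
elim: n => [|n IH] in x y z *.
  by rewrite ltn0 => H; exfalso; move: H.
rewrite ltnS => le_n.
have t1x t : tstar (tword [::]) t = t.
  exact: (star_of1x tprec_bilin tdot_bilin).
have tx1 t : tstar t (tword [::]) = t.
  exact: (star_ofx1 tdotC tprec_bilin tdot_bilin).
case: x le_n => [|a x] le_n; first by rewrite !t1x.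
case: y le_n => [|b y] le_n; first by rewrite tx1 t1x.
case: z le_n => [|c z] le_n; first by rewrite !tx1.
have E1 := IH x (b :: y) (c :: z); have E2 := IH (a :: x) y (c :: z).
have E3 := IH x y (c :: z); have E4 := IH (a :: x) (b :: y) z.
have E5 := IH x (b :: y) z; have E6 := IH (a :: x) y z; have E7 := IH x y z.
move: le_n E1 E2 E3 E4 E5 E6 E7; rewrite /= !(addSn, addnS) => le_n.
have l1 := ltnW le_n; have l2 := ltnW l1.
move=> /(_ le_n) E1 /(_ le_n) E2 /(_ l1) E3 /(_ le_n) E4 /(_ l1) E5 /(_ l1) E6.
move=> /(_ l2) E7.
move: E1 E2 E3 E4 E5 E6 E7; rewrite !twordS.
exact: (assoc_step inj_linear tcons_bilin.2 tstar_bilin (@nmulA K R) tstar_cons).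
Qed.

Lemma tprec_consl a x t : tprec (tcons a x) t = tcons a (tstar x (inj t)).
Proof.
have [cl cr] := tcons_bilin; have [pl pr] := tprec_bilin.
have [sl sr] := tstar_bilin.
suff H : tprec (tcons a x) =1 (fun t => tcons a (tstar x (inj t))).
  exact: (H t).
apply: Tbar_eq => [||[b s]]; first exact: pr.
  exact: (lin_comp (lin_comp inj_linear (sr x)) (cr a)).
by rewrite -tconsE tprec_cons.
Qed.

Lemma trilin_eq (f g : Tbar R -> Tbar R -> Tbar R -> Tbar R) :
  (forall y z, linear (fun x => f x y z)) -> (forall y z, linear (fun x => g x y z)) ->
  (forall x z, linear (fun y => f x y z)) -> (forall x z, linear (fun y => g x y z)) ->
  (forall x y, linear (fun z => f x y z)) -> (forall x y, linear (fun z => g x y z)) ->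
  (forall a b c s u v, f (tcons a (tword s)) (tcons b (tword u)) (tcons c (tword v))
     = g (tcons a (tword s)) (tcons b (tword u)) (tcons c (tword v))) ->
  forall x y z, f x y z = g x y z.
Proof.
move=> f1 g1 f2 g2 f3 g3 e x y z.
suff H : f^~ y ^~ z =1 g ^~ y ^~ z by exact: (H x).
apply: Tbar_eq => [||[a s]]; [exact: f1|exact: g1|].
suff H : f (tensor (a, s)) ^~ z =1 g (tensor (a, s)) ^~ z by exact: (H y).
apply: Tbar_eq => [||[b u]]; [exact: f2|exact: g2|].
suff H : f (tensor (a, s)) (tensor (b, u)) =1 g (tensor (a, s)) (tensor (b, u)).
  exact: (H z).
apply: Tbar_eq => [||[c v]]; [exact: f3|exact: g3|].
by rewrite -!tconsE.
Qed.

Lemma lin_sum (L M : lmodType K) (f g : L -> M) :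
  linear f -> linear g -> linear (fun x => f x + g x).
Proof. by move=> lf lg k x y; rewrite lf lg scalerDr addrACA. Qed.

Lemma tprecA x y z :
  tprec (tprec x y) z = tprec x (tprec y z + tprec z y + tdot y z).
Proof.
have [pl pr] := tprec_bilin; have [dl dr] := tdot_bilin.
move: x y z; apply: trilin_eq => [y z|y z|x z|x z|x y|x y|a b c s u v].
- exact: (lin_comp (pl _) (pl _)).
- exact: pl.
- exact: (lin_comp (pr _) (pl _)).
- exact: (lin_comp (lin_sum (lin_sum (pl _) (pr _)) (dl _)) (pr _)).
- exact: pr.
- exact: (lin_comp (lin_sum (lin_sum (pr _) (pl _)) (dr _)) (pr _)).
rewrite (tprec_cons a) (tprec_consl a) (tprec_consl a) -!twordS.
rewrite tstarA_word; congr (tcons a (tstar (tword s) _)).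
by rewrite !twordS; exact: star_of_inj.
Qed.

Lemma tdot_prec x y z : tprec (tdot x y) z = tdot x (tprec y z).
Proof.
have [pl pr] := tprec_bilin; have [dl dr] := tdot_bilin.
move: x y z; apply: trilin_eq => [y z|y z|x z|x z|x y|x y|a b c s u v].
- exact: (lin_comp (dl _) (pl _)).
- exact: dl.
- exact: (lin_comp (dr _) (pl _)).
- exact: (lin_comp (pl _) (dr _)).
- exact: pr.
- exact: (lin_comp (pr _) (dr _)).
rewrite tdot_cons !tprec_cons tdot_cons -!twordS.
by rewrite tstarA_word.
Qed.

Lemma tdotA x y z : tdot (tdot x y) z = tdot x (tdot y z).
Proof.
have [dl dr] := tdot_bilin.
move: x y z; apply: trilin_eq => [y z|y z|x z|x z|x y|x y|a b c s u v].
- exact: (lin_comp (dl _) (dl _)).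
- exact: dl.
- exact: (lin_comp (dr _) (dl _)).
- exact: (lin_comp (dl _) (dr _)).
- exact: dr.
- exact: (lin_comp (dr _) (dr _)).
by rewrite !tdot_cons nmulA tstarA_word.
Qed.

(* The augmentation ideal of $T^q(R)$, which is [unital Tq]. *)
Definition Tq : ctdType K :=
  HB.pack (GRing.Lmodule.sort (Tbar R))
    (isCTD.Build K (Tbar R) tprec_bilin tdot_bilin tdotC tprecA tdot_prec tdotA).

Lemma Tq_dot a b (x y : unital Tq) :
  dot (tcons a x : Tq) (tcons b y) = tcons (nmul a b) (ustar x y).
Proof. exact: tdot_cons. Qed.

Lemma Tq_prec a b (x y : unital Tq) :
  prec (tcons a x : Tq) (tcons b y) = tcons a (ustar x (uinj (tcons b y : Tq))).
Proof. exact: tprec_cons. Qed.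

Lemma Tq_succ a b (x y : unital Tq) :
  prec (tcons b y : Tq) (tcons a x) = tcons b (ustar (uinj (tcons a x : Tq)) y).
Proof. exact: (etrans (tprec_cons b y a x) (congr1 (tcons b) (tstarC y _))). Qed.

End QuasiShuffle.

(* The inclusion $V \hookrightarrow \bar S(V) \hookrightarrow T^q(\bar S(V))$. *)
Definition incl (K : fieldType) (V : lmodType K) (v : V) :
  unital (Tq (Sbar V)) := uinj (tensor (svar v, [::]) : Tq (Sbar V)).

Section FreeCTD.
Variables (K : fieldType) (V : lmodType K).

Inductive term : Type :=
| Var of V | Zero | Add of term & term | Scale of K & term
| Prec of term & term | Dot of term & term.
HB.instance Definition _ := gen_eqMixin term.
HB.instance Definition _ := gen_choiceMixin term.

(* The congruence generated by the axioms of CTD-algebras and by the linearity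
   of [Var]. *)
Inductive teq : term -> term -> Prop :=
| teq_refl s : teq s s
| teq_sym s t : teq s t -> teq t s
| teq_trans s t u : teq s t -> teq t u -> teq s u
| teq_add s s' t t' : teq s s' -> teq t t' -> teq (Add s t) (Add s' t')
| teq_scale k s s' : teq s s' -> teq (Scale k s) (Scale k s')
| teq_prec s s' t t' : teq s s' -> teq t t' -> teq (Prec s t) (Prec s' t')
| teq_dot s s' t t' : teq s s' -> teq t t' -> teq (Dot s t) (Dot s' t')
| teq_addA s t u : teq (Add s (Add t u)) (Add (Add s t) u)
| teq_addC s t : teq (Add s t) (Add t s)
| teq_add0 s : teq (Add Zero s) s
| teq_addN s : teq (Add (Scale (-1) s) s) Zero
| teq_scaleA a b s : teq (Scale a (Scale b s)) (Scale (a * b) s)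
| teq_scale1 s : teq (Scale 1 s) s
| teq_scaleDr a s t : teq (Scale a (Add s t)) (Add (Scale a s) (Scale a t))
| teq_scaleDl a b s : teq (Scale (a + b) s) (Add (Scale a s) (Scale b s))
| teq_var k v w : teq (Var (k *: v + w)) (Add (Scale k (Var v)) (Var w))
| teq_precl k s t u :
    teq (Prec (Add (Scale k s) t) u) (Add (Scale k (Prec s u)) (Prec t u))
| teq_precr k s t u :
    teq (Prec u (Add (Scale k s) t)) (Add (Scale k (Prec u s)) (Prec u t))
| teq_dotl k s t u :
    teq (Dot (Add (Scale k s) t) u) (Add (Scale k (Dot s u)) (Dot t u))
| teq_dotC s t : teq (Dot s t) (Dot t s)
| teq_precA s t u : teq (Prec (Prec s t) u)
    (Prec s (Add (Add (Prec t u) (Prec u t)) (Dot t u)))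
| teq_dot_prec s t u : teq (Prec (Dot s t) u) (Dot s (Prec t u))
| teq_dotA s t u : teq (Dot (Dot s t) u) (Dot s (Dot t u)).

Definition teqb (s t : term) : bool := `[< teq s t >].

Lemma teqb_equiv : equiv_class_of teqb.
Proof.
split=> [s|s t|t s u].
- by apply/asboolP/teq_refl.
- by apply/idP/idP => /asboolP e; apply/asboolP/teq_sym.
- by move=> /asboolP e /asboolP e'; apply/asboolP/(teq_trans e).
Qed.
Canonical teqb_equiv_rel := EquivRelPack teqb_equiv.

Definition fterm := {eq_quot teqb}.
HB.instance Definition _ := Choice.on fterm.

Let p (t : term) : fterm := \pi_{eq_quot teqb} t.
Let r (x : fterm) : term := repr x.

Let rK x : p (r x) = x. Proof. exact: reprK. Qed.

Let p_eq s t : teq s t -> p s = p t.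
Proof. by move=> e; apply/eqP; rewrite eqquotE; apply/asboolP. Qed.

Let rp t : teq (r (p t)) t.
Proof.
have : p (r (p t)) = p t by rewrite rK.
by move/eqP; rewrite eqquotE => /asboolP.
Qed.

Definition fadd x y := p (Add (r x) (r y)).
Definition fscale k x := p (Scale k (r x)).
Definition fprec x y := p (Prec (r x) (r y)).
Definition fdot x y := p (Dot (r x) (r y)).
Definition fopp x := fscale (-1) x.

Let paddE s t : fadd (p s) (p t) = p (Add s t).
Proof. by apply/p_eq/teq_add; apply: rp. Qed.
Let pscaleE k s : fscale k (p s) = p (Scale k s).
Proof. by apply/p_eq/teq_scale/rp. Qed.
Let pprecE s t : fprec (p s) (p t) = p (Prec s t).
Proof. by apply/p_eq/teq_prec; apply: rp. Qed.
Let pdotE s t : fdot (p s) (p t) = p (Dot s t).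
Proof. by apply/p_eq/teq_dot; apply: rp. Qed.
Let pE := (paddE, pscaleE, pprecE, pdotE).

Lemma faddA : associative fadd.
Proof.
by move=> x y z; rewrite -[x]rK -[y]rK -[z]rK !pE; apply/p_eq/teq_addA.
Qed.
Lemma faddC : commutative fadd.
Proof. by move=> x y; rewrite -[x]rK -[y]rK !pE; apply/p_eq/teq_addC. Qed.
Lemma fadd0 : left_id (p Zero) fadd.
Proof. by move=> x; rewrite -[x]rK !pE; apply/p_eq/teq_add0. Qed.
Lemma faddN : left_inverse (p Zero) fopp fadd.
Proof. by move=> x; rewrite -[x]rK /fopp !pE; apply/p_eq/teq_addN. Qed.
HB.instance Definition _ :=
  GRing.isZmodule.Build fterm faddA faddC fadd0 faddN.

Let faddE x y : x + y = fadd x y :> fterm. Proof. by []. Qed.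

Lemma fscaleA a b x : fscale a (fscale b x) = fscale (a * b) x.
Proof. by rewrite -[x]rK !pE; apply/p_eq/teq_scaleA. Qed.
Lemma fscale1 : left_id 1 fscale.
Proof. by move=> x; rewrite -[x]rK !pE; apply/p_eq/teq_scale1. Qed.
Lemma fscaleDr : right_distributive fscale +%R.
Proof.
move=> a x y; rewrite !faddE -[x]rK -[y]rK !pE.
exact/p_eq/teq_scaleDr.
Qed.
Lemma fscaleDl x : {morph fscale^~ x : a b / a + b}.
Proof.
by move=> a b; rewrite !faddE -[x]rK !pE; apply/p_eq/teq_scaleDl.
Qed.
HB.instance Definition _ := GRing.Zmodule_isLmodule.Build K fterm
  fscaleA fscale1 fscaleDr fscaleDl.

Let fcombE k x y : k *: x + y = fadd (fscale k x) y :> fterm. Proof. by []. Qed.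

Lemma fdotC x y : fdot x y = fdot y x.
Proof. by rewrite -[x]rK -[y]rK !pE; apply/p_eq/teq_dotC. Qed.

Lemma fprec_bilin : bilin fprec.
Proof.
split=> [z k x y|z k x y].
  by rewrite !fcombE -[x]rK -[y]rK -[z]rK !pE; apply/p_eq/teq_precl.
by rewrite !fcombE -[x]rK -[y]rK -[z]rK !pE; apply/p_eq/teq_precr.
Qed.

Lemma fdot_bilin : bilin fdot.
Proof.
have l z : linear (fdot^~ z).
  move=> k x y.
  by rewrite !fcombE -[x]rK -[y]rK -[z]rK !pE; apply/p_eq/teq_dotl.
by split=> // z k x y; rewrite ![fdot z _]fdotC l.
Qed.

Lemma fprecA x y z :
  fprec (fprec x y) z = fprec x (fprec y z + fprec z y + fdot y z).
Proof.
by rewrite !faddE -[x]rK -[y]rK -[z]rK !pE; apply/p_eq/teq_precA.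
Qed.
Lemma fdot_prec x y z : fprec (fdot x y) z = fdot x (fprec y z).
Proof. by rewrite -[x]rK -[y]rK -[z]rK !pE; apply/p_eq/teq_dot_prec. Qed.
Lemma fdotA x y z : fdot (fdot x y) z = fdot x (fdot y z).
Proof. by rewrite -[x]rK -[y]rK -[z]rK !pE; apply/p_eq/teq_dotA. Qed.

HB.instance Definition _ := isCTD.Build K fterm
  fprec_bilin fdot_bilin fdotC fprecA fdot_prec fdotA.

Definition fvar (v : V) : fterm := p (Var v).

Lemma fvar_linear : linear fvar.
Proof. by move=> k v w; rewrite fcombE /fvar !pE; apply/p_eq/teq_var. Qed.
HB.instance Definition _ := GRing.isLinear.Build K V fterm *:%R fvar fvar_linear.

Section Eval.
Variables (A : ctdType K) (phi : {linear V -> A}).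

Fixpoint eval (t : term) : A :=
  match t with
  | Var v => phi v
  | Zero => 0
  | Add s t => eval s + eval t
  | Scale k t => k *: eval t
  | Prec s t => prec (eval s) (eval t)
  | Dot s t => dot (eval s) (eval t)
  end.

Lemma eval_teq s t : teq s t -> eval s = eval t.
Proof.
have [pl pr] := @prec_bilin K A; have [dl dr] := @dot_bilin K A.
elim=> //= *; try congruence.
- exact: addrA.
- exact: addrC.
- exact: add0r.
- by rewrite scaleN1r addNr.
- exact: scalerA.
- exact: scale1r.
- exact: scalerDr.
- exact: scalerDl.
- exact: linearP.
- exact: pl.
- exact: pr.
- exact: dl.
- exact: dotC.
- exact: precA.
- exact: dot_prec.
- exact: dotA.
Qed.

Let ev (x : fterm) : A := eval (r x).
Let evp t : ev (p t) = eval t. Proof. exact/eval_teq/rp. Qed.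

Let ev_linear : linear ev.
Proof. by move=> k x y; rewrite fcombE -[x]rK -[y]rK !pE !evp. Qed.

Definition uev (u : unital fterm) : unital A := (u.1, ev u.2).

Lemma uev_morphism : uctd_morphism uev.
Proof.
have ev0 := linear_at0 ev_linear.
have evprec x y : ev (prec x y) = prec (ev x) (ev y).
  by rewrite -[x]rK -[y]rK /prec /= pprecE !evp.
have evdot x y : ev (dot x y) = dot (ev x) (ev y).
  by rewrite -[x]rK -[y]rK /dot /= pdotE !evp.
split.
- by move=> k u v; apply: injective_projections => //=; rewrite ev_linear.
- by rewrite /uev /= ev0.
- by [].
- move=> u v _; rewrite /uev /uprec /= addrC ev_linear evprec.
  by rewrite [in RHS]addrC.
- by move=> u v _; rewrite /uev /udot /= evdot.
Qed.

Lemma uev_var v : uev (uinj (fvar v)) = uinj (phi v).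
Proof. by rewrite /uev /= evp. Qed.

Lemma uev_unique (g : unital fterm -> unital A) : uctd_morphism g ->
  (forall v, g (uinj (fvar v)) = uinj (phi v)) -> g =1 uev.
Proof.
case=> gl g1 ga gp gd gv.
have inj_lin (B : ctdType K) : linear (@uinj K B).
  by move=> k x y; apply: injective_projections; rewrite /= ?scaler0 ?addr0.
have aug (B : ctdType K) (x y : B) : udef (uinj x) (uinj y) by left.
have gt t : g (uinj (p t)) = uinj (eval t).
  elim: t => [v||s IHs t IHt|k t IH|s IHs t IHt|s IHs t IHt] /=.
  - exact: gv.
  - exact: (linear_at0 gl).
  - have -> : p (Add s t) = 1 *: p s + p t by rewrite scale1r faddE pE.
    by rewrite inj_lin gl IHs IHt -inj_lin scale1r.
  - have -> : p (Scale k t) = k *: p t + 0 by rewrite addr0 -pscaleE.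
    rewrite inj_lin gl IH (linear_at0 gl : g (uinj 0) = 0).
    by rewrite -(linear_at0 (inj_lin A)) -inj_lin addr0.
  - by rewrite -pprecE -(uprec_inj (p s) (p t)) (gp _ _ (aug _ _ _)) IHs IHt uprec_inj.
  - by rewrite -pdotE -(udot_inj (p s) (p t)) (gd _ _ (aug _ _ _)) IHs IHt udot_inj.
move=> [k x].
have -> : (k, x) = k *: uone fterm + uinj x.
  apply: injective_projections => /=; last by rewrite scaler0 add0r.
  by rewrite addr0; exact: (esym (mulr1 k)).
rewrite gl g1 (uctd_linear uev_morphism) (uctd_one uev_morphism).
by congr (_ + _); rewrite -[x]rK gt /uev /= evp.
Qed.
End Eval.

Lemma free_uctd_exists :
  exists (F : ctdType K) (i : {linear V -> F}), free_uctd i.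
Proof.
exists fterm, fvar => A phi; exists (uev phi); split.
- exact: uev_morphism.
- exact: uev_var.
- exact: uev_unique.
Qed.
End FreeCTD.

(* Main.v *)
Require Import Defs.
From mathcomp Require Import all_boot ssralg.
From HB Require Import structures.

Set Implicit Arguments.
Unset Strict Implicit.
Unset Printing Implicit Defensive.
Import GRing.Theory.
Local Open Scope ring_scope.

(** The space $T^q(\bar S(V))$, with $V$ sitting in it as the one-letter words
    on variables, has itself the universal property of the free unital
    CTD-algebra ([Tq_free]); two objects with the same universal property are
    isomorphic through the morphisms that match the copies of $V$
    ([free_uctd_iso]), and such a morphism is $\Phi$.

    The universal property is a composition of two adjunctions.  The operation
    $\cdot$ of a CTD-algebra $A$ is commutative and associative, so a linear map
    $\phi : V \to A$ extends to a homomorphism $\sigma$ from $\bar S(V)$ to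
    $(A, \cdot)$ ([slift], [sliftM]).  For any commutative algebra $R$ and any
    homomorphism $f : R \to (A, \cdot)$, a morphism on $T^q(R)$ that extends $f$
    has only one possible value on a word, because $ax = a \prec x$ in $T^q(R)$:
    $$a_1 \cdots a_n \mapsto
      f(a_1) \prec (f(a_2) \prec (\cdots \prec f(a_n))).$$
    This map is a morphism ([qlift_morphism]).  The point is that $*$ is the
    product that turns $\prec$ into a right action,
    $(a \prec u) \prec v = a \prec (u * v)$, and that
    $(a \prec u) \cdot (b \prec v) = (a \cdot b) \prec (u * v)$ holds in every
    CTD-algebra ([ractsA], [dot_racts2]): these are the formulas that define the
    quasi-shuffle operations on $ax$ and $by$, so an induction on words shows
    that the map respects $*$, and then $\prec$ and $\cdot$.

    Uniqueness holds because $V$ generates: the elements of $\bar S(V)$ are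
    linear combinations of $\cdot$-products of variables, and words are nested
    $\prec$-products of letters ([Tq_morphism_eq]). *)

(** * Morphisms of unital CTD-algebras and free objects *)

Section UnitalMorphisms.
Variable K : fieldType.

Lemma uinj_linear (A : ctdType K) : linear (@uinj K A).
Proof. by move=> k x y; apply: injective_projections; rewrite /= ?scaler0 ?addr0. Qed.

Lemma uctd_morphism_id (A : ctdType K) : uctd_morphism (@id (unital A)).
Proof. by []. Qed.

Lemma uctd_morphism_comp (A B C : ctdType K)
    (g : unital B -> unital C) (f : unital A -> unital B) :
  uctd_morphism g -> uctd_morphism f -> uctd_morphism (g \o f).
Proof.
move=> [gl g1 ga gp gd] [fl f1 fa fp fd].
have fdef u v : udef u v -> udef (f u) (f v) by case=> /fa; [left|right].
split=> [||u /fa/ga //|u v duv|u v duv] /=.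
- exact: lin_comp fl gl.
- by rewrite f1 g1.
- by rewrite fp // gp //; apply: fdef.
- by rewrite fd // gd //; apply: fdef.
Qed.

Definition ctd_morphism (A B : ctdType K) (f : A -> B) :=
  [/\ linear f, forall x y, f (prec x y) = prec (f x) (f y)
    & forall x y, f (dot x y) = dot (f x) (f y)].

Definition umap (A B : ctdType K) (f : A -> B) (u : unital A) : unital B :=
  (u.1, f u.2).

Lemma umap_inj (A B : ctdType K) (f : A -> B) x : umap f (uinj x) = uinj (f x).
Proof. by []. Qed.

Lemma umap_linear (A B : ctdType K) (f : A -> B) : linear f -> linear (umap f).
Proof. by move=> fl k u v; apply: injective_projections => //=; rewrite fl. Qed.

Lemma umap_morphism (A B : ctdType K) (f : A -> B) :
  ctd_morphism f -> uctd_morphism (umap f).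
Proof.
move=> [fl fp fd]; split=> //=.
- exact: umap_linear.
- by rewrite /umap /= (linear_at0 fl).
- move=> u v _; rewrite /umap /uprec /= addrC fl fp.
  by rewrite [in RHS]addrC.
- by move=> u v _; rewrite /umap /udot /= fd.
Qed.

Lemma free_uctd_endo (V : lmodType K) (F : ctdType K) (i : {linear V -> F})
    (f : unital F -> unital F) : free_uctd i -> uctd_morphism f ->
  (forall v, f (uinj (i v)) = uinj (i v)) -> f =1 id.
Proof.
move=> /(_ F i) [e [_ _ eu]] fm fi u.
by rewrite (eu _ fm fi) -(eu _ (uctd_morphism_id F)).
Qed.

(** Both composites of the two comparison morphisms fix the copy of $V$, hence
    are the identity by [free_uctd_endo]. *)
Lemma free_uctd_iso (V : lmodType K) (F F' : ctdType K)
    (i : {linear V -> F}) (j : {linear V -> F'}) :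
  free_uctd i -> free_uctd j ->
  exists Phi : unital F -> unital F',
    [/\ uctd_isomorphism Phi,
        forall v, Phi (uinj (i v)) = uinj (j v) &
        forall Psi : unital F -> unital F', uctd_morphism Psi ->
          (forall v, Psi (uinj (i v)) = uinj (j v)) -> Psi =1 Phi].
Proof.
move=> hF hF'.
have [f [fm fi fu]] := hF F' j; have [g [gm gj _]] := hF' F i.
exists f; split=> //; split=> //; exists g; split=> // u.
- apply: (free_uctd_endo hF (uctd_morphism_comp gm fm)) => v /=.
  by rewrite fi gj.
- apply: (free_uctd_endo hF' (uctd_morphism_comp fm gm)) => v /=.
  by rewrite gj fi.
Qed.

End UnitalMorphisms.

(** * The right action of a unital CTD-algebra on its augmentation ideal *)

Section UnitalAction.
Variables (K : fieldType) (A : ctdType K).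
Implicit Types (a b : A) (u v : unital A).

(** $a \prec u$ for $a$ in the augmentation ideal and $u$ in the whole unital
    algebra, so that the end of a word, where $u = 1$, needs no separate case. *)
Definition racts a u : A := prec a u.2 + (u.1 : K) *: a.

Lemma racts_inj a x : racts a (uinj x) = prec a x.
Proof. by rewrite /racts scale0r addr0. Qed.

Lemma racts1 a : racts a (uone A) = a.
Proof. by rewrite /racts /= (linear_at0 ((@prec_bilin K A).2 a)) scale1r add0r. Qed.

Lemma racts_bilin : bilin (racts : A -> unital A -> A).
Proof.
have [pl pr] := @prec_bilin K A.
split=> [u k a b|a k u v]; rewrite /racts.
  by rewrite pl scalerDr !scalerA mulrC -scalerA scalerDr addrACA.
by rewrite /= pr scalerDl -scalerA scalerDr addrACA.
Qed.

Lemma unital_decomp u : u = u.1 *: uone A + uinj u.2.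
Proof.
case: u => k x; apply: injective_projections => /=.
  by rewrite addr0; exact: (esym (mulr1 k)).
by rewrite scaler0 add0r.
Qed.

Lemma unital_eq (M : lmodType K) (f g : unital A -> M) :
  linear f -> linear g -> f (uone A) = g (uone A) ->
  (forall x, f (uinj x) = g (uinj x)) -> f =1 g.
Proof. by move=> fl gl e1 ei u; rewrite [u]unital_decomp fl gl e1 ei. Qed.

Lemma ustar_bilin : bilin (@ustar K A).
Proof. exact: (star_of_bilin (@dotC K A) (@prec_bilin K A) (@dot_bilin K A)). Qed.

Lemma ustarC u v : ustar u v = ustar v u.
Proof. exact: (star_ofC _ (@dotC K A)). Qed.

(** The axiom for $(x \prec y) \prec z$, extended to the unit: the unital algebra
    under $*$ acts on the right by $\prec$. *)
Lemma ractsA a u v : racts (racts a u) v = racts a (ustar u v).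
Proof.
have [rl rr] := racts_bilin; have [sl sr] := ustar_bilin.
suff H : (fun u => racts (racts a u) v) =1 (fun u => racts a (ustar u v)).
  exact: (H u).
apply: unital_eq => [|||x].
- exact: (lin_comp (rr a) (rl v)).
- exact: (lin_comp (sl v) (rr a)).
- by rewrite racts1 ustar1u.
suff H : racts (racts a (uinj x)) =1 (fun v => racts a (ustar (uinj x) v)).
  exact: (H v).
apply: unital_eq => [|||y].
- exact: rr.
- exact: (lin_comp (sr _) (rr a)).
- by rewrite racts1 ustaru1.
- by rewrite ustar_inj !racts_inj precA.
Qed.

Lemma dot_racts a b u : racts (dot a b) u = dot a (racts b u).
Proof.
have [dl dr] := @dot_bilin K A.
by rewrite /racts dot_prec addrC [in RHS]addrC dr.
Qed.

(** The rule $ax \cdot by = (a \cdot b)(x * y)$ of the quasi-shuffle algebra is a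
    consequence of the axioms: move $\prec$ out of one factor, then out of the
    other, and compose the two actions. *)
Lemma dot_racts2 a b u v :
  dot (racts a u) (racts b v) = racts (dot a b) (ustar u v).
Proof. by rewrite -dot_racts dotC -dot_racts ractsA (dotC b). Qed.

Definition comalg_of : nonUnitalComAlgType K :=
  HB.pack (GRing.Lmodule.sort A)
    (isNonUnitalComAlg.Build K A (@dot_bilin K A) (@dotC K A)
       (fun x y z => esym (dotA x y z))).

End UnitalAction.

(** * Extension of a homomorphism from the letters to the quasi-shuffle algebra *)

Lemma Tbar_bilin_eq (K : fieldType) (R M : lmodType K)
    (f g : Tbar R -> Tbar R -> M) :
  (forall y, linear (f^~ y)) -> (forall y, linear (g^~ y)) ->
  (forall x, linear (f x)) -> (forall x, linear (g x)) ->
  (forall w w', f (tensor w) (tensor w') = g (tensor w) (tensor w')) ->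
  forall x y, f x y = g x y.
Proof.
move=> fl gl fr gr e x y.
apply: (Tbar_eq (fl y) (gl y)) => w.
exact: (Tbar_eq (fr _) (gr _)).
Qed.

Section QuasiShuffleExtension.
Variables (K : fieldType) (R : nonUnitalComAlgType K) (A : ctdType K).
Variable (f : R -> A).
Hypotheses (f_lin : linear f) (fM : forall a b, f (nmul a b) = dot (f a) (f b)).

Fixpoint nest (s : seq R) : unital A :=
  if s is a :: s' then uinj (racts (f a) (nest s')) else uone A.

Lemma nestS a s : nest (a :: s) = uinj (racts (f a) (nest s)).
Proof. by []. Qed.

Lemma nest_multilin u v : linear (fun a => nest (u ++ a :: v)).
Proof.
have [rl rr] := @racts_bilin K A.
elim: u => [|c u IH] k a b /=.
  by rewrite f_lin rl uinj_linear.
by rewrite IH rr uinj_linear.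
Qed.

Definition qlift : Tq R -> A := tlift (fun w => racts (f w.1) (nest w.2)).

Lemma qlift_multilin : multilin (fun w => racts (f w.1) (nest w.2)).
Proof.
have [rl rr] := @racts_bilin K A.
move=> [|c u] v k a b /=; first by rewrite f_lin rl.
by rewrite nest_multilin rr.
Qed.

Lemma qlift_linear : linear qlift.
Proof. exact: (tlift_linear qlift_multilin). Qed.

Lemma qlift_tensor a s : qlift (tensor (a, s)) = racts (f a) (nest s).
Proof. exact: (tliftE qlift_multilin (a, s)). Qed.

Lemma umap_qlift_tword s : umap qlift (tword s) = nest s.
Proof.
case: s => [|a s]; rewrite /umap /=; first by rewrite (linear_at0 qlift_linear).
by rewrite qlift_tensor.
Qed.

Lemma qlift_tcons a (x : unital (Tq R)) :
  qlift (tcons a x) = racts (f a) (umap qlift x).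
Proof.
suff H : (fun x => qlift (tcons a x)) =1 (fun x => racts (f a) (umap qlift x)).
  exact: (H x).
apply: T_eq => [||s].
- exact: (lin_comp ((tcons_bilin R).2 a) qlift_linear).
- exact: (lin_comp (umap_linear qlift_linear) ((@racts_bilin K A).2 (f a))).
- by rewrite tconsE qlift_tensor umap_qlift_tword.
Qed.

(** The recursion for the product of the words $au$ and $bv$ is carried, term by
    term, to $x * y = x \prec y + y \prec x + x \cdot y$, where $x$ and $y$ are
    the images of $au$ and $bv$. *)
Lemma qlift_qstar u v : umap qlift (qstar u v) = ustar (nest u) (nest v).
Proof.
have qD x y : qlift (x + y) = qlift x + qlift y.
  by have := qlift_linear 1 x y; rewrite !scale1r.
elim: u v => [|a u IHu] v; first by rewrite ustar1u umap_qlift_tword.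
elim: v => [|b v IHv]; first by rewrite qstars0 ustaru1 umap_qlift_tword.
have inj t : umap qlift (0, t) = uinj (qlift t) by [].
(* The three summands are the images of a(u * bv), b(au * v), (a . b)(u * v). *)
rewrite qstarE inj qD qD !qlift_tcons !IHu IHv fM -dot_racts2 -ractsA.
by rewrite (ustarC (nest (a :: u))) -ractsA !nestS !racts_inj ustar_inj.
Qed.

Lemma qlift_morphism : ctd_morphism qlift.
Proof.
have ql := qlift_linear.
have [Al Ar] := @prec_bilin K A; have [Dl Dr] := @dot_bilin K A.
have [pl pr] := tprec_bilin R; have [dl dr] := tdot_bilin R.
split=> [||]; first exact: ql.
- apply: Tbar_bilin_eq => [y|y|x|x|[a u] [b v]].
  + exact: (lin_comp (pl y) ql).
  + exact: (lin_comp ql (Al (qlift y))).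
  + exact: (lin_comp (pr x) ql).
  + exact: (lin_comp ql (Ar (qlift x))).
  rewrite [prec _ _](tprecE (a, u) (b, v)) qlift_tcons !qlift_tensor.
  by rewrite qlift_qstar -ractsA nestS racts_inj.
- apply: Tbar_bilin_eq => [y|y|x|x|[a u] [b v]].
  + exact: (lin_comp (dl y) ql).
  + exact: (lin_comp ql (Dl (qlift y))).
  + exact: (lin_comp (dr x) ql).
  + exact: (lin_comp ql (Dr (qlift x))).
  rewrite [dot _ _](tdotE (a, u) (b, v)) qlift_tcons !qlift_tensor.
  by rewrite qlift_qstar fM dot_racts2.
Qed.

End QuasiShuffleExtension.

(** * Extension of a linear map to the reduced symmetric algebra *)

Section SymmetricExtension.
Variables (K : fieldType) (V : lmodType K) (B : nonUnitalComAlgType K).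

(** The product of the unitization $K1 \oplus B$.  The unit makes products over
    words iterated products in a commutative monoid, so that invariance under
    permutation of the factors is the general one; no element of $B$ is lost,
    as nonempty products stay in $B$ ([sprodS]). *)
Definition umul : unital B -> unital B -> unital B :=
  star_of (fun _ _ => 0) (@nmul K B).

Lemma zero_bilin : bilin (fun _ _ : B => 0 : B).
Proof. by split=> ? ? ? ?; rewrite scaler0 addr0. Qed.

Lemma umul_bilin : bilin umul.
Proof. exact: (star_of_bilin (@nmulC K B) zero_bilin (@nmul_bilin K B)). Qed.

Lemma umulC : commutative umul.
Proof. exact: (star_ofC _ (@nmulC K B)). Qed.

Lemma umul1 : left_id ((1, 0) : unital B) umul.
Proof. exact: (star_of1x zero_bilin (@nmul_bilin K B)). Qed.

Lemma umul_inj x y : umul (0, x) (0, y) = (0, nmul x y).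
Proof. by rewrite /umul star_of_inj !add0r. Qed.

Lemma umulA : associative umul.
Proof.
have [nl nr] := @nmul_bilin K B.
have nlZ (k : K) (x y : B) : nmul (k *: x) y = k *: nmul x y.
  by have := nl y k x 0; rewrite (linear_at0 (nl y)) !addr0.
have nrZ (k : K) (x y : B) : nmul x (k *: y) = k *: nmul x y.
  by have := nr x k y 0; rewrite (linear_at0 (nr x)) !addr0.
have nlD (x x' y : B) : nmul (x + x') y = nmul x y + nmul x' y.
  by have := nl y 1 x x'; rewrite !scale1r.
have nrD (x y y' : B) : nmul x (y + y') = nmul x y + nmul x y'.
  by have := nr x 1 y y'; rewrite !scale1r.
move=> [k x] [l y] [m z]; rewrite /umul /star_of /=.
apply: injective_projections => /=; first exact: mulrA.
rewrite !add0r !nlD !nrD !nlZ !nrZ !scalerDr !scalerA nmulA.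
rewrite (mulrC m k) (mulrC m l).
by rewrite [RHS](AC ((1*2)*(1*(1*2))) ((1*(3*5))*((2*(4*6))*7))).
Qed.

HB.instance Definition _ :=
  Monoid.isComLaw.Build (unital B) (1, 0) umul umulA umulC umul1.

Variable phi : {linear V -> B}.

Definition sprod (s : seq V) : unital B :=
  \big[umul/(1, 0)]_(v <- s) ((0, phi v) : unital B).

Lemma sprodS v s : sprod (v :: s) = (0, (sprod (v :: s)).2).
Proof. by rewrite /sprod big_cons /umul /star_of /= mul0r. Qed.

Lemma sprod_multilin u v : linear (fun a => sprod (u ++ a :: v)).
Proof.
have [ul ur] := umul_bilin.
move=> k a b; rewrite /sprod !big_cat !big_cons /=.
have -> : ((0, phi (k *: a + b)) : unital B) = k *: (0, phi a) + (0, phi b).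
  by apply: injective_projections; rewrite /= ?linearP ?scaler0 ?addr0.
by rewrite ul ur.
Qed.

Definition sfold : Tbar V -> B := tlift (fun w => (sprod (w.1 :: w.2)).2).

Lemma sfold_multilin : multilin (fun w => (sprod (w.1 :: w.2)).2).
Proof.
move=> [|c u] v k a b; first by rewrite /= (sprod_multilin [::]).
by rewrite /= (sprod_multilin (c :: u)).
Qed.

Lemma sfold_linear : linear sfold.
Proof. exact: (tlift_linear sfold_multilin). Qed.

HB.instance Definition _ :=
  GRing.isLinear.Build K (Tbar V) B *:%R sfold sfold_linear.

Lemma sfoldE w : sfold (tensor w) = (sprod (w.1 :: w.2)).2.
Proof. exact: (tliftE sfold_multilin). Qed.

Lemma sfold_sym g : sym_rel g -> sfold g = 0.
Proof.
by case=> w w' p; rewrite raddfB /= !sfoldE /sprod (perm_big _ p) subrr.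
Qed.

Definition slift (x : Sbar V) : B := sfold (lrepr x).

Lemma slift_linear : linear slift.
Proof. exact: (lift_linear (f := sfold) sfold_sym). Qed.

Lemma slift_pi t : slift (lpi (@sym_rel K V) t) = sfold t.
Proof. exact: (lift_lreprE (f := sfold) sfold_sym). Qed.

Lemma slift_var v : slift (svar v) = phi v.
Proof. by rewrite [LHS]slift_pi sfoldE /sprod big_seq1. Qed.

Lemma sfold_tcat x y : sfold (tcat x y) = nmul (sfold x) (sfold y).
Proof.
have [tl tr] := @tcat_bilin K V; have [nl nr] := @nmul_bilin K B.
move: x y; apply: Tbar_bilin_eq => [y|y|x|x|w w'].
- exact: (lin_comp (tl y) sfold_linear).
- exact: (lin_comp sfold_linear (nl _)).
- exact: (lin_comp (tr x) sfold_linear).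
- exact: (lin_comp sfold_linear (nr _)).
rewrite tcatE !sfoldE /= -cat_cons.
have -> : sprod ((w.1 :: w.2) ++ w'.1 :: w'.2)
    = umul (sprod (w.1 :: w.2)) (sprod (w'.1 :: w'.2)) by exact: big_cat.
by rewrite [in LHS]sprodS [X in umul _ X]sprodS umul_inj.
Qed.

Lemma sliftM x y : slift (nmul x y) = nmul (slift x) (slift y).
Proof. by rewrite [LHS]slift_pi sfold_tcat. Qed.

End SymmetricExtension.

(** * The quasi-shuffle algebra on the symmetric algebra is free *)

Section Generation.
Variables (K : fieldType) (V : lmodType K).

(** The variables generate: $v_1 v_2 \cdots v_n$ is the product of $v_1$ and
    $v_2 \cdots v_n$. *)
Lemma Sbar_gen (P : Sbar V -> Prop) : P 0 ->
  (forall k x y, P x -> P y -> P (k *: x + y)) ->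
  (forall v, P (svar v)) -> (forall x y, P x -> P y -> P (nmul x y)) ->
  forall x, P x.
Proof.
move=> P0 PD Pv PM x; rewrite -[x](lreprK (x : Sbar_lmod V)).
elim/Tbar_ind: (lrepr _) => [|k [v s] t IH]; first by rewrite raddf0.
rewrite lpiP; apply: PD => //; elim: s v {IH} => [|w s IH] v; first exact: Pv.
have -> : lpi (@sym_rel K V) (tensor (v, w :: s)) =
    nmul (svar v) (lpi (@sym_rel K V) (tensor (w, s)) : Sbar V).
  by rewrite [RHS]smul_pi tcatE.
exact: PM.
Qed.

(** Words are nested $\prec$-products of their letters, whence the only possible
    value of a morphism on them. *)
Lemma Tq_word (R : nonUnitalComAlgType K) (a : R) s :
  tword (a :: s) =
  uprec (uinj (tensor (a, [::]) : Tq R)) (tword s : unital (Tq R)).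
Proof.
case: s => [|b s]; first by rewrite uprecx1.
rewrite [RHS](@uprec_inj _ (Tq R)) [prec _ _](tprecE (a, [::])).
exact: (congr1 (@uinj K (Tq R)) (esym (tconsE a (b :: s)))).
Qed.

Lemma Tq_letterM (R : nonUnitalComAlgType K) (a b : R) :
  uinj (tensor (nmul a b, [::]) : Tq R) =
  udot (uinj (tensor (a, [::]) : Tq R)) (uinj (tensor (b, [::]) : Tq R)).
Proof.
rewrite udot_inj [dot _ _](tdotE (a, [::]) (b, [::])).
exact: (congr1 (@uinj K (Tq R)) (esym (tconsE _ [::]))).
Qed.

Definition tqvar (v : V) : Tq (Sbar V) := tensor (svar v, [::]).

Lemma tqvar_linear : linear tqvar.
Proof.
move=> k v w; rewrite /tqvar -(tensor_multilin [::] [::]).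
congr tensor; congr (_, _).
by rewrite /svar (tensor_multilin [::] [::]) lpiP.
Qed.
HB.instance Definition _ :=
  GRing.isLinear.Build K V (Tq (Sbar V)) *:%R tqvar tqvar_linear.

(** A morphism respects $\prec$, hence is determined by the letters, and respects
    $\cdot$, hence is determined on the letters by the variables. *)
Lemma Tq_morphism_eq (A : ctdType K) (g h : unital (Tq (Sbar V)) -> unital A) :
  uctd_morphism g -> uctd_morphism h ->
  (forall v, g (incl v) = h (incl v)) -> g =1 h.
Proof.
move=> [gl g1 ga gp gd] [hl h1 ha hp hd] e.
have il k x y : uinj (tensor (k *: x + y, [::]) : Tq (Sbar V)) =
    k *: uinj (tensor (x, [::]) : Tq (Sbar V)) + uinj (tensor (y, [::]) : Tq _).
  by rewrite -uinj_linear (tensor_multilin [::] [::]).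
have letter (a : Sbar V) :
    g (uinj (tensor (a, [::]) : Tq (Sbar V))) =
    h (uinj (tensor (a, [::]) : Tq _)).
  elim/Sbar_gen: a => [|k x y IHx IHy|v|x y IHx IHy].
  - have := il (-1) 0 0; rewrite scaler0 addr0 scaleN1r addNr => ->.
    by rewrite !linear_at0.
  - by rewrite il gl hl IHx IHy.
  - exact: e.
  - by rewrite Tq_letterM gd ?hd ?IHx ?IHy //; left.
apply: T_eq => // s; elim: s => [|a s IH]; first by rewrite g1 h1.
by rewrite Tq_word gp ?hp ?letter ?IH //; left.
Qed.

Lemma Tq_free : free_uctd tqvar.
Proof.
move=> A phi.
pose sigma := slift (phi : {linear V -> comalg_of A}).
have sl : linear (sigma : Sbar V -> A).
  exact: (@slift_linear _ _ (comalg_of A) phi).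
have sM a b : sigma (nmul a b) = dot (sigma a : A) (sigma b).
  exact: (@sliftM _ _ (comalg_of A) phi).
have m := umap_morphism (qlift_morphism sl sM).
have ev v : umap (qlift sigma) (incl v) = uinj (phi v).
  rewrite umap_inj qlift_tensor // racts1.
  by rewrite [sigma _]slift_var.
exists (umap (qlift sigma)); split=> // g gm gv.
by apply: Tq_morphism_eq => // v; rewrite ev -gv.
Qed.

End Generation.

Theorem theorem2p5 (K : fieldType) (V : lmodType K)
    (F : ctdType K) (i : {linear V -> F}) (hF : free_uctd i) :
  exists Phi : unital F -> unital (Tq (Sbar V)),
    [/\ uctd_isomorphism Phi,
        forall v, Phi (uinj (i v)) = incl v &
        forall Psi : unital F -> unital (Tq (Sbar V)), uctd_morphism Psi ->
          (forall v, Psi (uinj (i v)) = incl v) -> Psi =1 Phi].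
Proof. exact: (free_uctd_iso hF (@Tq_free K V)). Qed.
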